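(* Let $M,m$ be coprime positive integers, $m_2\in\mathbf Z$ with $0\le m_2\le m$, and let $\heartsuit\in\{\mathrm{I},\mathrm{II},\mathrm{III},\mathrm{IV}\}$ and integers $(k_1,k_2)$ be in the admissible range for type $\heartsuit$ (see context). Write $N^{(\pm)\mathrm{tw}}_\heartsuit=\big[\widehat R^{(\pm)\mathrm{tw}}\cdot\mathrm{ch}^{(\pm)\mathrm{tw}}_{L(\Lambda^{(M)(m,m_2)(\heartsuit)}_{k_1,k_2})}\big](\tau,z_1,z_2,t)$. Put $(c,\varepsilon)=((-1)^{m_2+1},\frac12)$ for the sign $+$ and $(c,\varepsilon)=(1,0)$ for the sign $-$. Then, for both signs: (i) $N^{(\pm)\mathrm{tw}}_{\mathrm I}=c\,e^{\frac{2\pi im}M(t-\frac\tau4)}e^{\frac{2\pi im}M[(k_1+\frac12)z_1-(k_1+k_2-\frac12)z_2]}q^{\frac mM[k_1(k_1+k_2)+\frac12k_2]}\,\Phi^{(A(1|1))[m,-m_2+1]}(M\tau,\ -z_2+(k_1+\frac12)\tau+\varepsilon,\ z_1+(k_1+k_2-\frac12)\tau-\varepsilon,\ 0)$; (ii) $N^{(\pm)\mathrm{tw}}_{\mathrm{II}}=c\,e^{\frac{2\pi im}M(t-\frac\tau4)}e^{\frac{2\pi im}M[-(k_1-\frac12)z_1+(k_1+k_2+\frac12)z_2]}q^{\frac mM[k_1(k_1+k_2)-\frac12k_2]}\,\Phi^{(A(1|1))[m,-m_2+1]}(M\tau,\ z_2+(k_1-\frac12)\tau+\varepsilon,\ -z_1+(k_1+k_2+\frac12)\tau-\varepsilon,\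 0)$; (iii) $N^{(\pm)\mathrm{tw}}_{\mathrm{III}}=c\,e^{\frac{2\pi im}M(t-\frac\tau4)}e^{\frac{2\pi im}M[(k_1+k_2+\frac12)z_1-(k_1-\frac12)z_2]}q^{\frac mM[k_1(k_1+k_2)-\frac12k_2]}\,\Phi^{(A(1|1))[m,-m_2+1]}(M\tau,\ z_1+(k_1-\frac12)\tau+\varepsilon,\ -z_2+(k_1+k_2+\frac12)\tau-\varepsilon,\ 0)$; (iv) $N^{(\pm)\mathrm{tw}}_{\mathrm{IV}}=c\,e^{\frac{2\pi im}M(t-\frac\tau4)}e^{\frac{2\pi im}M[-(k_1+k_2-\frac12)z_1+(k_1+\frac12)z_2]}q^{\frac mM[k_1(k_1+k_2)+\frac12k_2]}\,\Phi^{(A(1|1))[m,-m_2+1]}(M\tau,\ -z_1+(k_1+\frac12)\tau+\varepsilon,\ z_2+(k_1+k_2-\frac12)\tau-\varepsilon,\ 0)$.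
   Context: Functions. $q=e^{2\pi i\tau}$. For $m\in\mathbf Z_{>0}$, $s\in\mathbf Z$: $\Phi^{(A(1|1))[m,s]}_1(\tau,z_1,z_2,t)=e^{-2\pi imt}\sum_{j\in\mathbf Z}\frac{e^{2\pi imj(z_1+z_2)+2\pi isz_1}q^{mj^2+sj}}{(1-e^{2\pi iz_1}q^j)^2}$, $\Phi^{(A(1|1))[m,s]}_2(\tau,z_1,z_2,t)=e^{-2\pi imt}\sum_{j\in\mathbf Z}\frac{e^{-2\pi imj(z_1+z_2)-2\pi isz_2}q^{mj^2+sj}}{(1-e^{-2\pi iz_2}q^j)^2}$, $\Phi^{(A(1|1))[m,s]}=\Phi^{(A(1|1))[m,s]}_1-\Phi^{(A(1|1))[m,s]}_2$. Affine superalgebra. $\widehat A(1,1)$ is the affine Lie superalgebra of $sl(2|2)/\mathbf CI$ with simple roots $\alpha_0,\alpha_2$ (even), $\alpha_1,\alpha_3$ (odd), and $(\alpha_0|\alpha_0)=2$, $(\alpha_2|\alpha_2)=-2$, $(\alpha_1|\alpha_1)=(\alpha_3|\alpha_3)=(\alpha_1|\alpha_3)=(\alpha_0|\alpha_2)=0$, $(\alpha_0|\alpha_1)=(\alpha_0|\alpha_3)=-1$, $(\alpha_1|\alpha_2)=(\alpha_2|\alpha_3)=1$ (so $\alpha_1,\alpha_3$ coincide as functions on the Cartan subalgebra). $\delta=\sum_{i=0}^3\alpha_i$, $\theta=\alpha_1+\alpha_2+\alpha_3$, $(\Lambda_0|\alpha_j)=\delta_{j,0}$, $(\Lambda_0|\Lambda_0)=0$,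 $\rho=-\frac12(\alpha_1+\alpha_3)$, dual Coxeter number $0$. The Cartan subalgebra is identified with its dual via $(\cdot|\cdot)$, with coordinates $(\tau,z_1,z_2,t)=2\pi i(-\tau\Lambda_0+z+t\delta)$, $z=-\frac{z_1-z_2}2(\alpha_1+\alpha_3)-z_1\alpha_2$; thus $e^{-\alpha_1}=e^{-\alpha_3}=e^{2\pi iz_1}$, $e^{-\alpha_2}=e^{-2\pi i(z_1+z_2)}$, $e^{\Lambda_0}=e^{2\pi it}$, $e^{-\delta}=q$. Put $t_\alpha(\lambda)=\lambda+(\lambda|\delta)\alpha-\{\frac{(\alpha|\alpha)}2(\lambda|\delta)+(\lambda|\alpha)\}\delta$, $r_\theta(\lambda)=\lambda-(\lambda|\theta)\theta$, $r_{\alpha_2}(\lambda)=\lambda+(\lambda|\alpha_2)\alpha_2$, and $w.\lambda=w(\lambda+\rho)-\rho$. Characters. All characters are normalized (super)characters ($+$: character, $-$: supercharacter), $\widehat R^{(\pm)}$ is the (super)denominator, and ''numerator'' means the product $\widehat R^{(\pm)}\mathrm{ch}^{(\pm)}$. They are given by the following formulas. For $0\le m_2\le m$ let $\Lambda^{(m,m_2)}=m\Lambda_0+\frac{m_2}2(\alpha_1+\alpha_3)$ and $F^{(\pm)}=\sum_{j\in\mathbf Z}t_{j\theta}\Big(\frac{e^{\Lambda^{(m,m_2)}+\rho}}{(1\pm e^{-\alpha_1})(1\pm e^{-\alpha_3})}\Big)$; then $\widehat R^{(\pm)}\mathrm{ch}^{(\pm)}_{L(\Lambda^{(m,m_2)})}=F^{(\pm)}-r_\theta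 F^{(\pm)}$. With $\beta[b_1,b_2]:=-\frac{b_1-b_2}2(\alpha_1+\alpha_3)-b_1\alpha_2$, the types and their admissible ranges are: (I) $\overline y=1$, $\beta=\beta[k_1,-(k_1+k_2)]$, $k_1,k_2\ge0$, $2k_1+k_2\le M-1$; (II) $\overline y=r_\theta r_{\alpha_2}$, $\beta=\beta[-k_1,k_1+k_2]$, $k_1,k_2\ge1$, $2k_1+k_2\le M$; (III) $\overline y=r_{\alpha_2}$, $\beta=\beta[k_1+k_2,-k_1]$, $k_1\ge0$, $k_2\ge1$, $2k_1+k_2\le M-1$; (IV) $\overline y=r_\theta$, $\beta=\beta[-(k_1+k_2),k_1]$, $k_1\ge1$, $k_2\ge0$, $2k_1+k_2\le M$. The principal admissible weight is $\Lambda^{(M)(m,m_2)(\heartsuit)}_{k_1,k_2}=(t_\beta\overline y).(\Lambda^{(m,m_2)}-(M-1)\frac mM\Lambda_0)$ and its irreducible highest weight module has $[\widehat R^{(\pm)}\mathrm{ch}^{(\pm)}_{L(\Lambda^{(M)(m,m_2)(\heartsuit)}_{k_1,k_2})}](\tau,z,t)=[\widehat R^{(\pm)}\mathrm{ch}^{(\pm)}_{L(\Lambda^{(m,m_2)})}]\big(M\tau,\overline y^{-1}(z+\tau\beta),\frac1M(t+(z|\beta)+\frac{\tau|\beta|^2}2)\big)$. Twisted functions are $f^{\mathrm{tw}}(h)=f(w_0h)$ (for $f=\widehat R^{(\pm)},\mathrm{ch}^{(\pm)}$) with $w_0=r_{\alpha_2}t_{-\frac12\alpha_2}$, i.e. $w_0(\tau,z_1,z_2,t)=(\tau,-z_2+\frac\tau2,-z_1+\frac\tau2,t+\frac{z_1+z_2}2-\frac\tau4)$.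 *)

(* Defs.v *)
From HB Require Import structures.
From mathcomp Require Import all_boot all_order all_algebra.
From mathcomp Require Import all_classical all_reals all_analysis.
From mathcomp Require Import complex ring.
From mathcomp.analysis.showcase Require summability.

Set Implicit Arguments.
Unset Strict Implicit.
Unset Printing Implicit Defensive.

Import Order.TTheory GRing.Theory Num.Theory.
Import numFieldNormedType.Exports.

Local Open Scope ring_scope.
Local Open Scope complex_scope.

Definition cexp {R : realType} (w : R[i]) : R[i] :=
  (expR (complex.Re w) * cos (complex.Im w)) +i*
  (expR (complex.Re w) * sin (complex.Im w)).

Definition twopii {R : realType} : R[i] := 0 +i* (2 * pi).

Definition e2pii {R : realType} (x : R[i]) : R[i] := cexp (twopii * x).

(* q^x for q = e^(2 pi i tau); for non-integral x this is the usual branch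
   e^(2 pi i x tau). *)
Definition qpow {R : realType} (tau x : R[i]) : R[i] := e2pii (x * tau).

(* Unconditional sum: the limit of the finite partial sums along the directed
   set of finite subsets of Z. *)
Definition zsum {R : realType} (f : int -> R[i]) : R[i] :=
  @summability.sum int R[i] (R[i])^o f.

Definition Phi1 {R : realType} (m : nat) (s : int) (tau z1 z2 t : R[i]) : R[i] :=
  e2pii (- (m%:R * t)) *
  zsum (fun j =>
    e2pii (m%:R * j%:~R * (z1 + z2)) * e2pii (s%:~R * z1) *
      qpow tau (m%:R * j%:~R ^+ 2 + s%:~R * j%:~R) /
    (1 - e2pii z1 * qpow tau j%:~R) ^+ 2).

Definition Phi2 {R : realType} (m : nat) (s : int) (tau z1 z2 t : R[i]) : R[i] :=
  e2pii (- (m%:R * t)) *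
  zsum (fun j =>
    e2pii (- (m%:R * j%:~R * (z1 + z2))) * e2pii (- (s%:~R * z2)) *
      qpow tau (m%:R * j%:~R ^+ 2 + s%:~R * j%:~R) /
    (1 - e2pii (- z2) * qpow tau j%:~R) ^+ 2).

Definition Phi {R : realType} (m : nat) (s : int) (tau z1 z2 t : R[i]) : R[i] :=
  Phi1 m s tau z1 z2 t - Phi2 m s tau z1 z2 t.

(* (tau, z1, z2) is not a pole of Phi m s: no summand of Phi1 or Phi2 has a
   vanishing denominator. *)
Definition Phi_regular {R : realType} (tau z1 z2 : R[i]) : Prop :=
  forall j : int, 1 - e2pii z1 * qpow tau j%:~R != 0 /\
                  1 - e2pii (- z2) * qpow tau j%:~R != 0.

(* Coordinates with respect to the basis Lambda_0, alpha_0, alpha_1, alpha_2;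
   alpha_3 coincides with alpha_1 on the Cartan subalgebra. *)
Definition cartan (R : realType) := 'rV[R[i]]_4.

Definition cvec {R : realType} (a b c d : R[i]) : cartan R :=
  \row_(i < 4) [:: a; b; c; d]`_i.

Definition Lambda0 {R : realType} : cartan R := cvec 1 0 0 0.
Definition alpha0 {R : realType} : cartan R := cvec 0 1 0 0.
Definition alpha1 {R : realType} : cartan R := cvec 0 0 1 0.
Definition alpha2 {R : realType} : cartan R := cvec 0 0 0 1.
Definition alpha3 {R : realType} : cartan R := alpha1.

Definition gram {R : realType} : 'M[R[i]]_4 :=
  \matrix_(i < 4, j < 4)
    (nth [::] [:: [:: 0;  1;  0;  0];
                  [:: 1;  2; -1;  0];
                  [:: 0; -1;  0;  1];
                  [:: 0;  0;  1; -2]] i)`_j.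

Definition bform {R : realType} (u v : cartan R) : R[i] :=
  (u *m gram *m v^T) 0 0.

Definition delta {R : realType} : cartan R := alpha0 + alpha1 + alpha2 + alpha3.
Definition theta {R : realType} : cartan R := alpha1 + alpha2 + alpha3.
Definition rho {R : realType} : cartan R := - (2^-1 *: (alpha1 + alpha3)).

Definition transl {R : realType} (alpha lam : cartan R) : cartan R :=
  lam + bform lam delta *: alpha -
  (bform alpha alpha / 2 * bform lam delta + bform lam alpha) *: delta.

Definition r_theta {R : realType} (lam : cartan R) : cartan R :=
  lam - bform lam theta *: theta.

Definition r_alpha2 {R : realType} (lam : cartan R) : cartan R :=
  lam + bform lam alpha2 *: alpha2.

Definition dot_act {R : realType} (w : cartan R -> cartan R) (lam : cartan R) :
  cartan R := w (lam + rho) - rho.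

(* The finite part of the coordinates; also the vector beta[b1,b2]. *)
Definition zvec {R : realType} (z1 z2 : R[i]) : cartan R :=
  - (((z1 - z2) / 2) *: (alpha1 + alpha3)) - z1 *: alpha2.

Definition cartan_point {R : realType} (tau : R[i]) (z : cartan R) (t : R[i]) :
  cartan R := twopii *: (- (tau *: Lambda0) + z + t *: delta).

Definition wexp {R : realType} (lam h : cartan R) : R[i] := cexp (bform lam h).

(* The domain |e^(-delta)| < 1, that is, Im tau > 0. *)
Definition convergence_domain {R : realType} (h : cartan R) : Prop :=
  0 < complex.Re (bform delta h).

Variant char_sign := CharPlus | CharMinus.

Definition pm {R : realType} (s : char_sign) : R[i] :=
  match s with CharPlus => 1 | CharMinus => -1 end.

Definition Lambda_int {R : realType} (m : nat) (m2 : int) : cartan R :=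
  m%:R *: Lambda0 + (m2%:~R / 2) *: (alpha1 + alpha3).

(* w (e^(Lam + rho) / ((1 +- e^(- alpha1)) (1 +- e^(- alpha3)))),
   where w e^lam = e^(w lam). *)
Definition F_term {R : realType} (s : char_sign) (Lam : cartan R)
    (w : cartan R -> cartan R) (h : cartan R) : R[i] :=
  wexp (w (Lam + rho)) h /
  ((1 + pm s * wexp (w (- alpha1)) h) * (1 + pm s * wexp (w (- alpha3)) h)).

Definition t_theta {R : realType} (j : int) : cartan R -> cartan R :=
  transl (j%:~R *: theta).

(* F - r_theta F, where F is the sum over j of t_(j theta) applied to
   e^(Lam + rho) / ((1 +- e^(- alpha1)) (1 +- e^(- alpha3))). *)
Definition int_numerator {R : realType} (s : char_sign) (Lam h : cartan R) :
  R[i] :=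
  zsum (fun j => F_term s Lam (t_theta j) h) -
  zsum (fun j => F_term s Lam (r_theta \o t_theta j) h).

Definition F_term_regular {R : realType} (s : char_sign)
    (w : cartan R -> cartan R) (h : cartan R) : Prop :=
  1 + pm s * wexp (w (- alpha1)) h != 0 /\ 1 + pm s * wexp (w (- alpha3)) h != 0.

(* h is not a pole of int_numerator s Lam. *)
Definition int_regular {R : realType} (s : char_sign) (h : cartan R) : Prop :=
  forall j : int, F_term_regular s (t_theta j) h /\
                  F_term_regular s (r_theta \o t_theta j) h.

Variant adm_type := TypeI | TypeII | TypeIII | TypeIV.

Definition in_range (T : adm_type) (M : nat) (k1 k2 : int) : Prop :=
  match T with
  | TypeI => [/\ 0 <= k1, 0 <= k2 & 2 * k1 + k2 <= M%:Z - 1]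
  | TypeII => [/\ 1 <= k1, 1 <= k2 & 2 * k1 + k2 <= M%:Z]
  | TypeIII => [/\ 0 <= k1, 1 <= k2 & 2 * k1 + k2 <= M%:Z - 1]
  | TypeIV => [/\ 1 <= k1, 0 <= k2 & 2 * k1 + k2 <= M%:Z]
  end.

Definition ybar {R : realType} (T : adm_type) : cartan R -> cartan R :=
  match T with
  | TypeI => id
  | TypeII => r_theta \o r_alpha2
  | TypeIII => r_alpha2
  | TypeIV => r_theta
  end.

Definition ybar_inv {R : realType} (T : adm_type) : cartan R -> cartan R :=
  match T with
  | TypeI => id
  | TypeII => r_alpha2 \o r_theta
  | TypeIII => r_alpha2
  | TypeIV => r_theta
  end.

Definition beta {R : realType} (T : adm_type) (k1 k2 : int) : cartan R :=
  match T with
  | TypeI => zvec k1%:~R (- (k1 + k2)%:~R)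
  | TypeII => zvec (- k1%:~R) (k1 + k2)%:~R
  | TypeIII => zvec (k1 + k2)%:~R (- k1%:~R)
  | TypeIV => zvec (- (k1 + k2)%:~R) k1%:~R
  end.

Definition Lambda_adm {R : realType} (M m : nat) (m2 : int) (T : adm_type)
    (k1 k2 : int) : cartan R :=
  dot_act (transl (beta T k1 k2) \o ybar T)
    (Lambda_int m m2 - ((M%:R - 1) * (m%:R / M%:R)) *: Lambda0).

Definition adm_point {R : realType} (M : nat) (T : adm_type) (k1 k2 : int)
    (tau : R[i]) (z : cartan R) (t : R[i]) : cartan R :=
  let b := beta T k1 k2 in
  cartan_point (M%:R * tau) (ybar_inv T (z + tau *: b))
    (M%:R^-1 * (t + bform z b + tau * bform b b / 2)).

Definition w0 {R : realType} : cartan R -> cartan R :=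
  r_alpha2 \o transl (- (2^-1 *: alpha2)).

Definition twist {R : realType} (f : cartan R -> R[i]) (h : cartan R) : R[i] :=
  f (w0 h).

Lemma bformE {R : realType} (u v : cartan R) :
  bform u v =
    u 0 0 * v 0 1 + u 0 1 * v 0 0 + 2 * u 0 1 * v 0 1
    - u 0 1 * v 0 2 - u 0 2 * v 0 1 + u 0 2 * v 0 3 + u 0 3 * v 0 2
    - 2 * u 0 3 * v 0 3.
Proof.
have o2 : lift ord0 (lift ord0 ord0) = 2 :> 'I_4 by exact: val_inj.
have o3 : lift ord0 (lift ord0 (lift ord0 ord0)) = 3 :> 'I_4 by exact: val_inj.
have o1 : lift ord0 ord0 = 1 :> 'I_4 by exact: val_inj.
rewrite /bform !mxE !(big_ord_recl, big_ord0) !mxE !(big_ord_recl, big_ord0).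
rewrite !mxE /= ?o1 ?o2 ?o3.
ring.
Qed.

Lemma cvecP {R : realType} (u v : cartan R) :
  u 0 0 = v 0 0 -> u 0 1 = v 0 1 -> u 0 2 = v 0 2 -> u 0 3 = v 0 3 -> u = v.
Proof.
move=> h0 h1 h2 h3; apply/rowP => -[[|[|[|[|//]]]] Hi].
- by move: h0; congr (u _ _ = v _ _); exact: val_inj.
- by move: h1; congr (u _ _ = v _ _); exact: val_inj.
- by move: h2; congr (u _ _ = v _ _); exact: val_inj.
- by move: h3; congr (u _ _ = v _ _); exact: val_inj.
Qed.

Lemma cvec_eta {R : realType} (u : cartan R) :
  u = cvec (u 0 0) (u 0 1) (u 0 2) (u 0 3).
Proof. by apply: cvecP; rewrite mxE. Qed.

Lemma cvecD {R : realType} (a b c d a' b' c' d' : R[i]) :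
  cvec a b c d + cvec a' b' c' d' = cvec (a + a') (b + b') (c + c') (d + d').
Proof. by apply: cvecP; rewrite !mxE. Qed.

Lemma cvecN {R : realType} (a b c d : R[i]) :
  - cvec a b c d = cvec (- a) (- b) (- c) (- d).
Proof. by apply: cvecP; rewrite !mxE. Qed.

Lemma cvecZ {R : realType} (x a b c d : R[i]) :
  x *: cvec a b c d = cvec (x * a) (x * b) (x * c) (x * d).
Proof. by apply: cvecP; rewrite !mxE. Qed.

Lemma bform_cvec {R : realType} (a b c d a' b' c' d' : R[i]) :
  bform (cvec a b c d) (cvec a' b' c' d') =
    a * b' + b * a' + 2 * b * b' - b * c' - c * b' + c * d' + d * c' - 2 * d * d'.
Proof. by rewrite bformE !mxE. Qed.

Definition cvec_simpl {R : realType} := (@cvecD R, @cvecN R, @cvecZ R).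

Lemma deltaE {R : realType} : delta = cvec 0 1 2 1 :> cartan R.
Proof. by rewrite /delta /alpha3 /alpha0 /alpha1 /alpha2 !cvec_simpl; congr cvec; ring. Qed.

Lemma thetaE {R : realType} : theta = cvec 0 0 2 1 :> cartan R.
Proof. by rewrite /theta /alpha3 /alpha1 /alpha2 !cvec_simpl; congr cvec; ring. Qed.

Lemma r_thetaE {R : realType} (a b c d : R[i]) :
  r_theta (cvec a b c d) = cvec a b (4 * b - c) (d - c + 2 * b).
Proof.
by rewrite /r_theta thetaE bform_cvec !cvec_simpl; congr cvec; ring.
Qed.

Lemma r_alpha2E {R : realType} (a b c d : R[i]) :
  r_alpha2 (cvec a b c d) = cvec a b c (c - d).
Proof.
by rewrite /r_alpha2 /alpha2 bform_cvec !cvec_simpl; congr cvec; ring.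
Qed.

Lemma ybarK {R : realType} (T : adm_type) : cancel (@ybar R T) (ybar_inv T).
Proof.
case: T => u //=; rewrite [u]cvec_eta ?(r_thetaE, r_alpha2E);
  by congr cvec; ring.
Qed.

Lemma pointE {R : realType} (tau z1 z2 t : R[i]) :
  cartan_point tau (zvec z1 z2) t =
  cvec (twopii * - tau) (twopii * t) (twopii * (2 * t - (z1 - z2)))
       (twopii * (t - z1)).
Proof.
rewrite /cartan_point /zvec deltaE /alpha3 /Lambda0 /alpha1 /alpha2 !cvec_simpl.
by congr cvec; field.
Qed.

Lemma w0_point {R : realType} (tau z1 z2 t : R[i]) :
  w0 (cartan_point tau (zvec z1 z2) t) =
  cartan_point tau (zvec (- z2 + tau / 2) (- z1 + tau / 2))
    (t + (z1 + z2) / 2 - tau / 4).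
Proof.
rewrite !pointE /w0 /= /transl deltaE /alpha2 !cvec_simpl !bform_cvec.
by rewrite r_alpha2E; congr cvec; field.
Qed.

Lemma bform_point {R : realType} (tau z1 z2 t : R[i])
    (h := cartan_point tau (zvec z1 z2) t) :
  [/\ bform (- alpha1) h = twopii * z1,
      bform (- alpha2) h = twopii * - (z1 + z2),
      bform Lambda0 h = twopii * t & bform (- delta) h = twopii * tau].
Proof.
by rewrite /h pointE deltaE /alpha1 /alpha2 /Lambda0 !cvec_simpl !bform_cvec; split; ring.
Qed.

(* Main.v *)
Require Import Defs.
From HB Require Import structures.
From mathcomp Require Import all_boot all_order all_algebra.
From mathcomp Require Import all_classical all_reals all_analysis.
From mathcomp Require Import complex finmap ring.
From mathcomp.analysis.showcase Require summability.

Set Implicit Arguments.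
Unset Strict Implicit.
Unset Printing Implicit Defensive.

Import Order.TTheory GRing.Theory Num.Theory.
Import numFieldNormedType.Exports.

Local Open Scope ring_scope.
Local Open Scope complex_scope.

(** The odd roots [alpha1] and [alpha3] agree on the Cartan subalgebra, so the
    denominator of each summand of [F] is a square, and at the point with
    coordinates [(tau, z1, z2, t)] the weight [t_(j theta) (Lambda + rho)]
    evaluates, up to [e^(2 pi i m t)], to the numerator of the summand of index
    [- j] in [Phi1], taken at [(tau, z1, - z2)].  For the character, the sign in
    [1 + e^(- alpha1)] is absorbed by moving [z1] and [z2] by one half, which
    leaves [z1 - z2] alone and costs the constant [(-1) ^ (m2 + 1)].  The
    reflection [r_theta] exchanges [z1] and [z2], and
    [Phi2 (z1, z2) = Phi1 (- z2, - z1)]; so the numerator of the integrable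
    module is a constant times an exponential times [Phi]
    ([int_numerator_Phi]).

    What remains is affine geometry.  The twist [w0], the translation by [beta]
    and the inverse of [ybar] all act on the coordinates by permutations, signs
    and shifts by multiples of [tau] ([adm_pointE]); the [delta]-coordinate of
    the resulting point, multiplied by [m], is the exponent of the prefactor in
    the theorem.  Each of the four types is [twisted_numerator] at that point,
    followed by a comparison of linear exponents.

    Pulling constants out of the sums and replacing [j] by [- j] need no
    convergence estimate: scaling by a nonzero constant preserves divergence as
    well as convergence, and negation permutes the finite subsets of [int]. *)

(** * The exponential [e2pii] *)

Lemma cexpD {R : realType} (v w : R[i]) : cexp (v + w) = cexp v * cexp w.
Proof.
case: v => a b; case: w => c d; rewrite /cexp /= expRD cosD sinD.
by apply/eqP; rewrite eq_complex /=; apply/andP; split; apply/eqP; ring.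
Qed.

Lemma e2piiD {R : realType} (x y : R[i]) : e2pii (x + y) = e2pii x * e2pii y.
Proof. by rewrite /e2pii mulrDr cexpD. Qed.

Lemma e2pii0 {R : realType} : e2pii 0 = 1 :> R[i].
Proof. by rewrite /e2pii mulr0 /cexp /= expR0 cos0 sin0 mulr1 mulr0. Qed.

Lemma e2pii_neq0 {R : realType} (x : R[i]) : e2pii x != 0.
Proof.
apply/eqP => x0; have /eqP := oner_neq0 R[i]; apply.
by rewrite -[LHS]e2pii0 -[X in e2pii X](subrr x) e2piiD x0 mul0r.
Qed.

Lemma e2pii_half {R : realType} : e2pii 2^-1 = -1 :> R[i].
Proof.
have -> : e2pii 2^-1 = cexp (0 +i* pi) :> R[i].
  rewrite /e2pii; congr cexp.
  have -> : twopii = 2 * (0 +i* pi) :> R[i].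
    rewrite /twopii [RHS]mulr_natl; apply/eqP.
    by rewrite eq_complex; apply/andP; split; apply/eqP => /=; ring.
  by field.
rewrite /cexp /= expR0 cospi sinpi mulr0 mul1r.
by apply/eqP; rewrite eq_complex /= oppr0 !eqxx.
Qed.

Lemma e2piiMint {R : realType} (n : int) (x : R[i]) :
  e2pii (n%:~R * x) = e2pii x ^ n.
Proof.
have nat_case k : e2pii (k%:R * x) = e2pii x ^+ k.
  elim: k => [|k IHk]; first by rewrite mul0r e2pii0.
  by rewrite -natr1 mulrDl mul1r e2piiD IHk exprSr.
case: n => k; first exact: nat_case.
rewrite -[RHS]/(e2pii x ^- k.+1) -nat_case.
apply: (mulfI (e2pii_neq0 (k.+1%:R * x))).
rewrite mulfV ?e2pii_neq0// -e2piiD NegzE mulrNz mulNr subrr.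
exact: e2pii0.
Qed.

(** * Unconditional sums over the integers *)

(** No summability is assumed: for a nonzero factor the scaled sum diverges
    together with the original one, and the limit of a divergent filter is the
    default point [0], which scaling fixes. *)
Lemma zsumZ {R : realType} (a : R[i]) (f : int -> R[i]) : a != 0 ->
  zsum (fun j => a * f j) = a * zsum f.
Proof.
move=> a0; have PF := @summability.totally_filter int.
pose ps := summability.partial_sum (f : int -> R[i]^o).
have ps_scale : summability.partial_sum ((fun j => a * f j) : int -> R[i]^o)
    = (a *: ps)%R.
  apply/funext => A; rewrite /ps /summability.partial_sum /=.
  by rewrite -mulr_sumr.
rewrite /zsum /summability.sum -/ps ps_scale.
have [cv|dv] := pselect (cvg (ps A @[A --> summability.totally])%classic).
  exact: (@limZl_tmp _ (R[i]^o) _ _ PF a ps cv).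
(* Both limits are now the default point, which is [0] by computation. *)
rewrite (dvgP dv) (dvgP (_ : ~ _)) ?is_cvgZlE//.
by rewrite [LHS]/(0 : R[i]) [X in a * X]/(0 : R[i]) mulr0.
Qed.

(** Negation permutes the finite subsets of [int] and respects inclusion, so it
    preserves the filter along which the sum is taken. *)
Lemma zsum_opp {R : realType} (f : int -> R[i]) :
  zsum (fun j => f (- j)) = zsum f.
Proof.
pose opp (A : {fset int}) := [fset - j | j in A]%fset.
have oppK A : opp (opp A) = A.
  apply/fsetP => j; apply/imfsetP/idP => [[k]|jA] /=.
    by case/imfsetP => l lA -> ->; rewrite opprK.
  by exists (- j); rewrite ?opprK//; apply/imfsetP; exists j.
have oppS A B : (A `<=` B -> opp A `<=` opp B)%fset.
  move=> /fsubsetP AB; apply/fsubsetP => j /imfsetP[/= l lA ->].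
  by apply/imfsetP; exists l => //=; exact: AB.
pose ps (g : int -> R[i]) := summability.partial_sum (g : int -> R[i]^o).
have ps_opp A : ps (fun j => f (- j)) A = ps f (opp A).
  rewrite /ps /summability.partial_sum /=.
  rewrite -(big_seq_fsetE _ A xpredT (fun j => f (- j))) /=.
  rewrite -(big_seq_fsetE _ (opp A) xpredT f) /= /opp big_imfset //=.
  by move=> i j _ _; exact: oppr_inj.
have same_filter : (ps (fun j => f (- j)) A @[A --> summability.totally]
                    = ps f A @[A --> summability.totally])%classic.
  apply/predeqP => P; split=> -[A _ AP]; exists (opp A) => // B /= AB.
    have /= := AP (opp B); rewrite ps_opp oppK.
    by apply; rewrite -[A]oppK; exact: oppS.
  by rewrite ps_opp; apply: AP => /=; rewrite -[A]oppK; exact: oppS.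
by rewrite /zsum /summability.sum [X in lim X]same_filter.
Qed.

(** * The sign of the denominator as a half-period shift *)

Definition sign_shift {R : realType} (s : char_sign) : R[i] :=
  if s is CharPlus then 2^-1 else 0.

Definition sign_const {R : realType} (s : char_sign) (m2 : int) : R[i] :=
  if s is CharPlus then (-1) ^ (m2 + 1) else 1.

(** Since [e2pii 2^-1 = -1], the denominators of the character are those of the
    supercharacter at a shifted point; this lets one computation serve both
    signs. *)
Lemma e2pii_sign_shift {R : realType} (s : char_sign) (x : R[i]) :
  1 + pm s * e2pii x = 1 - e2pii (x + sign_shift s).
Proof.
case: s; rewrite /= ?addr0 ?mulN1r// e2piiD e2pii_half mul1r.
by rewrite mulrN1 opprK.
Qed.

(** Shifting [z1] adds the opposite of this exponent to the contribution
    [- (m2 - 1) z1] of the top weight; compensating for it produces the constant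
    of the theorem. *)
Lemma sign_constE {R : realType} (s : char_sign) (m2 : int) :
  e2pii ((m2%:~R - 1) * sign_shift s) = sign_const s m2 :> R[i].
Proof.
case: s => /=; last by rewrite mulr0 e2pii0.
have -> : m2%:~R - 1 = (m2 - 1)%:~R :> R[i] by rewrite rmorphB.
rewrite e2piiMint e2pii_half.
have -> : m2 + 1 = (m2 - 1) + 2 by ring.
rewrite [RHS]expfzDr ?oppr_eq0 ?oner_eq0//.
by rewrite -[X in _ * X]/((-1) ^+ 2) sqrrN expr1n mulr1.
Qed.

(** * The integrable numerator as a mock theta function *)

Definition phi1_term {R : realType} (m : nat) (s : int) (tau z1 z2 : R[i])
    (j : int) : R[i] :=
  e2pii (m%:R * j%:~R * (z1 + z2)) * e2pii (s%:~R * z1) *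
    qpow tau (m%:R * j%:~R ^+ 2 + s%:~R * j%:~R) /
  (1 - e2pii z1 * qpow tau j%:~R) ^+ 2.

Lemma Phi1_zsum {R : realType} (m : nat) (s : int) (tau z1 z2 : R[i]) :
  Phi1 m s tau z1 z2 0 = zsum (phi1_term m s tau z1 z2).
Proof. by rewrite /Phi1 mulr0 oppr0 e2pii0 mul1r. Qed.

(** With [wexp_r_theta] this accounts for the antisymmetrization
    [F - r_theta F] becoming the difference [Phi1 - Phi2]. *)
Lemma Phi2_Phi1 {R : realType} (m : nat) (s : int) (tau z1 z2 t : R[i]) :
  Phi2 m s tau z1 z2 t = Phi1 m s tau (- z2) (- z1) t.
Proof.
rewrite /Phi2 /Phi1; congr (_ * zsum _); apply/funext => j.
by congr (e2pii _ * e2pii _ * _ / _); ring.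
Qed.

(** [n] is the coefficient of [delta] subtracted by the translation, from
    [(theta|theta) = 2], [(lambda|delta) = a] and [(lambda|theta) = c - 2 b]. *)
Lemma t_thetaE {R : realType} (j : int) (a b c d : R[i]) :
  let n := a * j%:~R ^+ 2 + (c - 2 * b) * j%:~R in
  t_theta j (cvec a b c d) =
  cvec a (b - n) (c + 2 * (a * j%:~R - n)) (d + a * j%:~R - n).
Proof.
rewrite /t_theta /transl thetaE deltaE !cvec_simpl !bform_cvec.
by congr cvec; field.
Qed.

Lemma Lambda_int_rhoE {R : realType} (m : nat) (m2 : int) :
  Lambda_int m m2 + rho = cvec m%:R 0 (m2%:~R - 1) 0 :> cartan R.
Proof.
rewrite /Lambda_int /rho /alpha3 /Lambda0 /alpha1 !cvec_simpl.
by congr cvec; field.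
Qed.

Lemma wexp_t_theta_top {R : realType} (m : nat) (m2 j : int)
    (tau z1 z2 t : R[i]) :
  wexp (t_theta j (Lambda_int m m2 + rho)) (cartan_point tau (zvec z1 z2) t) =
  e2pii (m%:R * t - m%:R * j%:~R * (z1 - z2) - (m2%:~R - 1) * z1 +
         (m%:R * j%:~R ^+ 2 + (m2%:~R - 1) * j%:~R) * tau).
Proof.
rewrite /wexp /e2pii Lambda_int_rhoE t_thetaE pointE bform_cvec.
by congr cexp; ring.
Qed.

Lemma wexp_t_theta_odd {R : realType} (j : int) (tau z1 z2 t : R[i]) :
  wexp (t_theta j (- alpha1)) (cartan_point tau (zvec z1 z2) t) =
  e2pii (z1 - j%:~R * tau).
Proof.
rewrite /wexp /e2pii /alpha1 cvecN t_thetaE pointE bform_cvec.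
by congr cexp; ring.
Qed.

Lemma wexp_r_theta {R : realType} (u : cartan R) (tau z1 z2 t : R[i]) :
  wexp (r_theta u) (cartan_point tau (zvec z1 z2) t) =
  wexp u (cartan_point tau (zvec z2 z1) t).
Proof.
rewrite /wexp [u]cvec_eta r_thetaE !pointE !bform_cvec; congr cexp; ring.
Qed.

Lemma F_term_r_theta {R : realType} (s : char_sign) (Lam : cartan R)
    (w : cartan R -> cartan R) (tau z1 z2 t : R[i]) :
  F_term s Lam (r_theta \o w) (cartan_point tau (zvec z1 z2) t) =
  F_term s Lam w (cartan_point tau (zvec z2 z1) t).
Proof.
have reflect_wexp : (fun u => wexp (r_theta u) (cartan_point tau (zvec z1 z2) t))
    = (fun u => wexp u (cartan_point tau (zvec z2 z1) t)).
  by apply/funext => u; exact: wexp_r_theta.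
(* Abstracting the evaluation keeps the weights from being unfolded into
   matrices when the two sides are compared. *)
exact: (congr1 (fun g => g (w (Lam + rho)) /
  ((1 + pm s * g (w (- alpha1))) * (1 + pm s * g (w (- alpha3))))) reflect_wexp).
Qed.

(** The translation [t_(j theta)] adds [j delta] to [- alpha1], and
    [e^(- delta) = q]; hence the index [- j] on the right. *)
Lemma F_term_t_theta {R : realType} (s : char_sign) (m : nat) (m2 j : int)
    (tau z1 z2 t : R[i]) :
  F_term s (Lambda_int m m2) (t_theta j) (cartan_point tau (zvec z1 z2) t) =
  sign_const s m2 * e2pii (m%:R * t) *
  phi1_term m (- m2 + 1) tau (z1 + sign_shift s) (- z2 - sign_shift s) (- j).
Proof.
transitivity (
    e2pii (m%:R * t - m%:R * j%:~R * (z1 - z2) - (m2%:~R - 1) * z1 +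
           (m%:R * j%:~R ^+ 2 + (m2%:~R - 1) * j%:~R) * tau) /
    (1 - e2pii (z1 - j%:~R * tau + sign_shift s)) ^+ 2).
  rewrite /F_term /alpha3 expr2 -e2pii_sign_shift.
  congr (_ / ((1 + _ * _) * (1 + _ * _))); last exact: wexp_t_theta_odd.
    exact: wexp_t_theta_top.
  exact: wexp_t_theta_odd.
rewrite /phi1_term -sign_constE !mulrA; congr (_ / _ ^+ 2).
  by rewrite /qpow -!e2piiD; congr e2pii; rewrite rmorphD !rmorphN /=; ring.
by rewrite /qpow -e2piiD; congr (1 - e2pii _); rewrite rmorphN /=; ring.
Qed.

Lemma zsum_t_theta {R : realType} (s : char_sign) (m : nat) (m2 : int)
    (tau z1 z2 t : R[i]) :
  zsum (fun j =>
    F_term s (Lambda_int m m2) (t_theta j) (cartan_point tau (zvec z1 z2) t)) =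
  sign_const s m2 * e2pii (m%:R * t) *
  Phi1 m (- m2 + 1) tau (z1 + sign_shift s) (- z2 - sign_shift s) 0.
Proof.
rewrite Phi1_zsum -[in RHS]zsum_opp -zsumZ; last first.
  by rewrite -sign_constE mulf_neq0 ?e2pii_neq0.
by congr zsum; apply/funext => j; exact: F_term_t_theta.
Qed.

Lemma int_numerator_Phi {R : realType} (s : char_sign) (m : nat) (m2 : int)
    (tau z1 z2 t : R[i]) :
  int_numerator s (Lambda_int m m2) (cartan_point tau (zvec z1 z2) t) =
  sign_const s m2 * e2pii (m%:R * t) *
  Phi m (- m2 + 1) tau (z1 + sign_shift s) (- z2 - sign_shift s) 0.
Proof.
rewrite /int_numerator /Phi mulrBr; congr (_ - _); first exact: zsum_t_theta.
transitivity (zsum (fun j => F_term s (Lambda_int m m2) (t_theta j)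
                               (cartan_point tau (zvec z2 z1) t))).
  by apply: (congr1 zsum); apply/funext => j; exact: F_term_r_theta.
have swap1 : - (- z2 - sign_shift s) = z2 + sign_shift s by ring.
by rewrite Phi2_Phi1 swap1 opprD; exact: zsum_t_theta.
Qed.

(** The two families of denominators, before and after [r_theta], are the
    factors of index [- j] in [Phi1] and [Phi2]. *)
Lemma int_regular_Phi {R : realType} (s : char_sign) (tau z1 z2 t : R[i]) :
  Phi_regular tau (z1 + sign_shift s) (- z2 - sign_shift s) ->
  int_regular s (cartan_point tau (zvec z1 z2) t).
Proof.
move=> reg j; have [reg1 reg2] := reg (- j).
have factor1 : 1 + pm s * wexp (t_theta j (- alpha1))
    (cartan_point tau (zvec z1 z2) t) != 0.
  rewrite wexp_t_theta_odd e2pii_sign_shift; move: reg1.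
  rewrite /qpow -e2piiD rmorphN; congr (1 - e2pii _ != 0); ring.
have factor2 : 1 + pm s * wexp ((r_theta \o t_theta j) (- alpha1))
    (cartan_point tau (zvec z1 z2) t) != 0.
  rewrite [wexp _ _](wexp_r_theta (t_theta j (- alpha1))) wexp_t_theta_odd.
  rewrite e2pii_sign_shift; move: reg2.
  rewrite /qpow -e2piiD rmorphN; congr (1 - e2pii _ != 0); ring.
exact: (conj (conj factor1 factor1) (conj factor2 factor2)).
Qed.

(** * The coordinates of the twisted admissible point *)

Lemma convergence_domain_point {R : realType} (tau z1 z2 t : R[i]) :
  0 < complex.Im tau ->
  convergence_domain (cartan_point tau (zvec z1 z2) t).
Proof.
move=> tau_gt0; rewrite /convergence_domain.
have -> : bform delta (cartan_point tau (zvec z1 z2) t) = - (twopii * tau).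
  by rewrite pointE deltaE bform_cvec; ring.
case: tau tau_gt0 => a b /= b_gt0.
by rewrite mul0r sub0r opprK !mulr_gt0 ?pi_gt0.
Qed.

Lemma zvecE {R : realType} (x1 x2 : R[i]) :
  zvec x1 x2 = cvec 0 0 (x2 - x1) (- x1).
Proof. by rewrite /zvec /alpha3 /alpha1 /alpha2 !cvec_simpl; congr cvec; field. Qed.

Lemma zvec_shift {R : realType} (tau x1 x2 b1 b2 : R[i]) :
  zvec x1 x2 + tau *: zvec b1 b2 = zvec (x1 + tau * b1) (x2 + tau * b2).
Proof. by rewrite !zvecE !cvec_simpl; congr cvec; ring. Qed.

Lemma r_theta_zvec {R : realType} (x1 x2 : R[i]) :
  r_theta (zvec x1 x2) = zvec x2 x1.
Proof. by rewrite !zvecE r_thetaE; congr cvec; ring. Qed.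

Lemma r_alpha2_zvec {R : realType} (x1 x2 : R[i]) :
  r_alpha2 (zvec x1 x2) = zvec (- x2) (- x1).
Proof. by rewrite !zvecE r_alpha2E; congr cvec; ring. Qed.

Lemma bform_zvec {R : realType} (x1 x2 b1 b2 : R[i]) :
  bform (zvec x1 x2) (zvec b1 b2) = - (x1 * b2 + x2 * b1).
Proof. by rewrite !zvecE bform_cvec; ring. Qed.

(** [b] holds the coordinates of [beta], and [y] those of
    [ybar_inv (z + tau beta)]; the last coordinate uses that [zvec] vectors pair
    by [- (x1 b2 + x2 b1)], so that [(beta|beta) / 2 = - b1 b2]. *)
Lemma adm_pointE {R : realType} (M : nat) (T : adm_type) (k1 k2 : int)
    (tau z1 z2 t : R[i]) :
  let l1 := k1%:~R in let l2 := k2%:~R in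
  let b := match T with
    | TypeI => (l1, - (l1 + l2)) | TypeII => (- l1, l1 + l2)
    | TypeIII => (l1 + l2, - l1) | TypeIV => (- (l1 + l2), l1) end in
  let x1 := z1 + tau * b.1 in let x2 := z2 + tau * b.2 in
  let y := match T with
    | TypeI => (x1, x2) | TypeII => (- x1, - x2)
    | TypeIII => (- x2, - x1) | TypeIV => (x2, x1) end in
  adm_point M T k1 k2 tau (zvec z1 z2) t =
  cartan_point (M%:R * tau) (zvec y.1 y.2)
    (M%:R^-1 * (t - z1 * b.2 - z2 * b.1 - tau * b.1 * b.2)).
Proof.
have height b1 b2 : t + bform (zvec z1 z2) (zvec b1 b2) +
    tau * bform (zvec b1 b2) (zvec b1 b2) / 2 =
    t - z1 * b2 - z2 * b1 - tau * b1 * b2 :> R[i].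
  by rewrite !bform_zvec; field.
by case: T; rewrite /adm_point /beta /ybar_inv /comp height rmorphD /=
  zvec_shift ?(r_theta_zvec, r_alpha2_zvec).
Qed.

(** The four types differ only in the coordinates [y1], [y2] and the height [u]
    of the point, so the argument is made once for arbitrary ones. *)
Lemma twisted_numerator {R : realType} (s : char_sign)
  (M m : nat) (m2 : int) (T : adm_type) (k1 k2 : int) (M_gt0 : (0 < M)%N)
  (Rhat : cartan R -> R[i]) (ch : cartan R -> cartan R -> R[i])
  (ch_int : forall h : cartan R,
    convergence_domain h -> int_regular s h ->
    Rhat h * ch (Lambda_int m m2) h = int_numerator s (Lambda_int m m2) h)
  (ch_adm : forall tau z1 z2 t : R[i],
    let h := cartan_point tau (zvec z1 z2) t in
    let h' := adm_point M T k1 k2 tau (zvec z1 z2) t in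
    0 < complex.Im tau -> int_regular s h' ->
    Rhat h * ch (Lambda_adm M m m2 T k1 k2) h =
    Rhat h' * ch (Lambda_int m m2) h')
  (tau z1 z2 t : R[i]) (tau_gt0 : 0 < complex.Im tau) (y1 y2 u Z1 Z2 : R[i]) :
  adm_point M T k1 k2 tau (zvec (- z2 + tau / 2) (- z1 + tau / 2))
    (t + (z1 + z2) / 2 - tau / 4) =
  cartan_point (M%:R * tau) (zvec y1 y2) (M%:R^-1 * u) ->
  Z1 = y1 + sign_shift s -> Z2 = - y2 - sign_shift s ->
  Phi_regular (M%:R * tau) Z1 Z2 ->
  twist Rhat (cartan_point tau (zvec z1 z2) t) *
    twist (ch (Lambda_adm M m m2 T k1 k2)) (cartan_point tau (zvec z1 z2) t) =
  sign_const s m2 * e2pii (m%:R / M%:R * u) *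
    Phi m (- m2 + 1) (M%:R * tau) Z1 Z2 0.
Proof.
move=> pointE' -> -> reg; have reg' := int_regular_Phi (M%:R^-1 * u) reg.
rewrite /twist w0_point ch_adm ?pointE'// ch_int//; last first.
  apply: convergence_domain_point; rewrite mulr_natl raddfMn /=.
  by rewrite pmulrn_lgt0.
by rewrite int_numerator_Phi mulrA.
Qed.

(** * The four types *)

(* Rhat and ch are the normalized (super)denominator and the normalized
   (super)characters ch_L(Lam), which enter only through the two formulas for
   their products, valid on the domain Im tau > 0 away from the poles. *)
Theorem proposition4p3 (R : realType) (s : char_sign)
  (M m : nat) (m2 : int) (T : adm_type) (k1 k2 : int)
  (M_gt0 : (0 < M)%N) (m_gt0 : (0 < m)%N) (coprime_Mm : coprime M m)
  (m2_ge0 : 0 <= m2) (m2_le : m2 <= m%:Z) (k_range : in_range T M k1 k2)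
  (Rhat : cartan R -> R[i]) (ch : cartan R -> cartan R -> R[i])
  (ch_int : forall h : cartan R,
    convergence_domain h -> int_regular s h ->
    Rhat h * ch (Lambda_int m m2) h = int_numerator s (Lambda_int m m2) h)
  (ch_adm : forall tau z1 z2 t : R[i],
    let h := cartan_point tau (zvec z1 z2) t in
    let h' := adm_point M T k1 k2 tau (zvec z1 z2) t in
    0 < complex.Im tau -> int_regular s h' ->
    Rhat h * ch (Lambda_adm M m m2 T k1 k2) h =
    Rhat h' * ch (Lambda_int m m2) h')
  (tau z1 z2 t : R[i]) (tau_gt0 : 0 < complex.Im tau) :
  let h := cartan_point tau (zvec z1 z2) t in
  let N := twist Rhat h * twist (ch (Lambda_adm M m m2 T k1 k2)) h in
  let c : R[i] := if s is CharPlus then (-1) ^ (m2 + 1) else 1 in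
  let eps : R[i] := if s is CharPlus then 2^-1 else 0 in
  let a : R[i] := m%:R / M%:R in
  let l1 : R[i] := k1%:~R in
  let l2 : R[i] := k2%:~R in
  [/\ T = TypeI ->
        let Z1 := - z2 + (l1 + 2^-1) * tau + eps in
        let Z2 := z1 + (l1 + l2 - 2^-1) * tau - eps in
        Phi_regular (M%:R * tau) Z1 Z2 ->
        N = c * e2pii (a * (t - tau / 4))
              * e2pii (a * ((l1 + 2^-1) * z1 - (l1 + l2 - 2^-1) * z2))
              * qpow tau (a * (l1 * (l1 + l2) + 2^-1 * l2))
              * Phi m (- m2 + 1) (M%:R * tau) Z1 Z2 0,
      T = TypeII ->
        let Z1 := z2 + (l1 - 2^-1) * tau + eps in
        let Z2 := - z1 + (l1 + l2 + 2^-1) * tau - eps in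
        Phi_regular (M%:R * tau) Z1 Z2 ->
        N = c * e2pii (a * (t - tau / 4))
              * e2pii (a * (- ((l1 - 2^-1) * z1) + (l1 + l2 + 2^-1) * z2))
              * qpow tau (a * (l1 * (l1 + l2) - 2^-1 * l2))
              * Phi m (- m2 + 1) (M%:R * tau) Z1 Z2 0,
      T = TypeIII ->
        let Z1 := z1 + (l1 - 2^-1) * tau + eps in
        let Z2 := - z2 + (l1 + l2 + 2^-1) * tau - eps in
        Phi_regular (M%:R * tau) Z1 Z2 ->
        N = c * e2pii (a * (t - tau / 4))
              * e2pii (a * ((l1 + l2 + 2^-1) * z1 - (l1 - 2^-1) * z2))
              * qpow tau (a * (l1 * (l1 + l2) - 2^-1 * l2))
              * Phi m (- m2 + 1) (M%:R * tau) Z1 Z2 0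
    & T = TypeIV ->
        let Z1 := - z1 + (l1 + 2^-1) * tau + eps in
        let Z2 := z2 + (l1 + l2 - 2^-1) * tau - eps in
        Phi_regular (M%:R * tau) Z1 Z2 ->
        N = c * e2pii (a * (t - tau / 4))
              * e2pii (a * (- ((l1 + l2 - 2^-1) * z1) + (l1 + 2^-1) * z2))
              * qpow tau (a * (l1 * (l1 + l2) + 2^-1 * l2))
              * Phi m (- m2 + 1) (M%:R * tau) Z1 Z2 0].
Proof.
  move=> h N c eps a l1 l2.
  have M_neq0 : M%:R != 0 :> R[i] by rewrite pnatr_eq0 -lt0n.
  have merge x y w P : c * e2pii x * e2pii y * qpow tau w * P =
      c * e2pii (x + y + w * tau) * P.
    by rewrite /qpow !e2piiD !mulrA.
  have point := adm_pointE M _ k1 k2 tau (- z2 + tau / 2) (- z1 + tau / 2)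
    (t + (z1 + z2) / 2 - tau / 4).
  split=> type_eq Z1 Z2 reg; rewrite merge; subst T.
  all: rewrite [N](twisted_numerator M_gt0 ch_int ch_adm tau_gt0 (point _)
    _ _ reg) /=.
  all: rewrite ?/Z1 ?/Z2 /l1 /l2.
  (* Only the side conditions on [Z1] and [Z2] are linear identities; the main
     goals are left to the last step. *)
  all: try by rewrite /eps /sign_shift; field.
  all: by congr (_ * e2pii _ * _); rewrite /a; field.
Qed.
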